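(* For all $1<\alpha\le2\le\beta<\infty$, $K\ge1$ and $D>0$ there exists a constant $C(K,D,\alpha,\beta)>0$, depending only on $K,D,\alpha,\beta$, such that the following holds. Let $\Psi\colon\mathbb{R}^n\to\mathbb{R}$ be convex and satisfy condition (C) and the growth condition $(G_{K,\alpha,\beta})$ (both defined in the context), let $\Psi^\ast$ be its Legendre transform, and let $\mu$ be a probability measure on $\mathbb{R}^n$, absolutely continuous with respect to Lebesgue measure, satisfying the modified logarithmic Sobolev inequality $mLSI(\Psi,D)$. Then for every Borel set $A\subseteq\mathbb{R}^n$ with $\mu(A)\ge1/2$ and every $u>0$, $$\mu\Big(A+\{x\in\mathbb{R}^n:\Psi^\ast(x)<u\}\Big)\ge1-2e^{\beta-u/C(K,D,\alpha,\beta)} .$$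
   Context: Condition (C) for $\Psi\colon\mathbb{R}^n\to[0,\infty]$: (C1) $\Psi(0)=0$ and $\Psi$ is continuous at $0$; (C2) $\Psi(x)>0$ for $x\ne0$; (C3) $\lim_{|x|\to\infty}\Psi(x)=\infty$; (C4) for every $x\in\mathbb{R}^n$ the function $t\mapsto\Psi(tx)$ is left-continuous on $(0,\infty)$; (C5) for every $x\in\mathbb{R}^n$ the function $t\mapsto\Psi(tx)/t$ is non-decreasing on $(0,\infty)$; (C6) $\Psi(x)=\Psi(-x)$ for all $x$. Growth condition $(G_{K,\alpha,\beta})$: for all $x\in\mathbb{R}^n\setminus\{0\}$ and all $t\ge1$, $K^{-1}t^\alpha\le\Psi(tx)/\Psi(x)\le Kt^\beta$. $mLSI(\Psi,D)$: for every bounded locally Lipschitz $f\colon\mathbb{R}^n\to(0,\infty)$, $$\mathrm{Ent}_\mu f^2\le D\,\mathbb{E}_\mu\Psi\Big(\frac{\nabla f}{f}\Big)f^2,$$ where $\mathbb{E}_\mu$ is integration with respect to $\mu$ and $\mathrm{Ent}_\mu g=\mathbb{E}_\mu g\log g-\mathbb{E}_\mu g\log\mathbb{E}_\mu g$ for $g\ge 0$. Legendre transform: $\Psi^\ast(x)=\sup_{y\in\mathbb{R}^n}(\langle x,y\rangle-\Psi(y))$. The sum of sets is the Minkowski sum $A+B=\{a+b:a\in A,b\in B\}$. *)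

(* Defs.v *)
From HB Require Import structures.
From mathcomp Require Export all_boot all_order all_algebra.
From mathcomp Require Export all_classical all_reals all_analysis.

Set Implicit Arguments.
Unset Strict Implicit.
Unset Printing Implicit Defensive.

Export Order.TTheory GRing.Theory Num.Theory.
Export numFieldNormedType.Exports.

Local Open Scope classical_set_scope.
Local Open Scope ring_scope.

(* R^n is 'rV[R]_n. The library's norm `|x| on 'rV[R]_n is the sup norm; it is
   used below only in notions that are the same for all norms (topology,
   |x| -> oo, differentiability, local Lipschitz continuity). *)

(* Same carrier as 'rV[R]_n, with the Borel sigma-algebra. *)
Definition borelRn (R : realType) (n : nat) :=
  g_sigma_algebraType (@open 'rV[R]_n).

Definition dotv (R : realType) (n : nat) (x y : 'rV[R]_n) : R :=
  \sum_(i < n) x 0 i * y 0 i.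

(* The n-fold product of the one-dimensional Lebesgue measure, evaluated by
   sections as in the library's product_measure1. Only its values on Borel sets
   are meaningful. *)
Fixpoint lebesgueRn (R : realType) (n : nat) : set 'rV[R]_n -> \bar R :=
  match n with
  | 0%N => fun A => (\1_A 0)%:E
  | m.+1 => fun A =>
      (\int[lebesgue_measure]_t
        @lebesgueRn R m [set x | A (row_mx (t%:M : 'M[R]_1) x)])%E
  end.

(* The vector of partial derivatives at the points of differentiability, and 0
   elsewhere (the default value of 'd). For locally Lipschitz f the exceptional
   set is Lebesgue-null by Rademacher's theorem, so the convention is immaterial
   for integrals against absolutely continuous measures. *)
Definition gradient (R : realType) (n : nat) (f : 'rV[R]_n -> R)
    (x : 'rV[R]_n) : 'rV[R]_n :=
  \row_(i < n) ('d f x : 'rV[R]_n -> R) (delta_mx 0 i).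

Record condition_C (R : realType) (n : nat) (Psi : 'rV[R]_n -> \bar R) : Prop := {
  C_ge0 : forall x : 'rV[R]_n, (0 <= Psi x)%E ;
  C1_zero : Psi 0 = 0%E ;
  C1_continuous : {for 0, continuous Psi} ;
  C2 : forall x : 'rV[R]_n, x != 0 -> (0 < Psi x)%E ;
  C3 : forall M : R, exists r : R,
    forall x : 'rV[R]_n, r < `|x| -> (M%:E < Psi x)%E ;
  C4 : forall (x : 'rV[R]_n) (t : R), 0 < t ->
    Psi (s *: x) @[s --> t^'-] --> Psi (t *: x) ;
  C5 : forall (x : 'rV[R]_n) (s t : R), 0 < s -> s <= t ->
    (Psi (s *: x) * (s^-1)%:E <= Psi (t *: x) * (t^-1)%:E)%E ;
  C6 : forall x : 'rV[R]_n, Psi x = Psi (- x)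
}.

Definition growth_condition (R : realType) (n : nat) (K alpha beta : R)
    (Psi : 'rV[R]_n -> R) : Prop :=
  forall x : 'rV[R]_n, x != 0 -> forall t : R, 1 <= t ->
    K^-1 * t `^ alpha <= Psi (t *: x) / Psi x <= K * t `^ beta.

(* ln 0 = 0 in the library, so 0 log 0 = 0. Taking fine of the mean is harmless
   for bounded g, the only case used below. *)
Definition entropy (R : realType) (n : nat) (mu : probability (borelRn R n) R)
    (g : 'rV[R]_n -> R) : \bar R :=
  let m := fine (\int[mu]_x (g x)%:E)%E in
  (\int[mu]_x (g x * ln (g x))%:E - (m * ln m)%:E)%E.

(* The library's local Lipschitz condition asks for |f u - f v| <= M |u - v| for
   (u, v) near every (x, y), also when x != y; off the diagonal this only says
   that f is locally bounded, which already follows from the case x = y. *)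
Definition mLSI (R : realType) (n : nat) (mu : probability (borelRn R n) R)
    (Psi : 'rV[R]_n -> \bar R) (D : R) : Prop :=
  forall f : 'rV[R]_n -> R,
    (forall x, 0 < f x) ->
    bounded_fun f ->
    [locally [lipschitz f x | x in setT]] ->
    (entropy mu (fun x => f x ^+ 2)%R <=
      D%:E * \int[mu]_x (Psi ((f x)^-1 *: gradient f x)%R * (f x ^+ 2)%:E))%E.

Definition legendre (R : realType) (n : nat) (Psi : 'rV[R]_n -> \bar R)
    (x : 'rV[R]_n) : \bar R :=
  ereal_sup [set ((dotv x y)%:E - Psi y)%E | y in setT].

Definition minkowski_sum (R : realType) (n : nat) (A B : set 'rV[R]_n) :
    set 'rV[R]_n :=
  [set a + b | a in A & b in B].

(* Main.v *)
(** Herbst's argument, run without derivatives. Let [L] be the Legendre transform of [Psi] and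
    [G x = min (u, inf_(y in A) L (x - y))], so that [{G < u} = A + {L < u}]. The lower growth
    bound on [Psi] gives [L (2 z) <= lam L z], whence [Psi (grad G) <= 2 lam G] wherever [G] is
    differentiable. Applied to [exp (t G / 2)], the modified log-Sobolev inequality becomes
    [t La' - La ln La <= a |t|^alpha La'] for [La t = E exp (t G)] and [|t| <= 2]. With the convexity
    of [ln La], this compares [ln (La t) / t] at [t] and [t / 2]; iterating towards [t = 0], both
    [ln (La t0)] and [- ln (La (- t0))] are comparable with [t0 E G]. Since [G = 0] on [A], the
    latter is at most [ln 2], so [La t0 <= 4], and Markov's inequality concludes. *)

Require Import Defs.
From mathcomp Require Import ring lra measurable_realfun.

Set Implicit Arguments.
Unset Strict Implicit.
Unset Printing Implicit Defensive.

Local Open Scope classical_set_scope.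
Local Open Scope ring_scope.

(** * Dyadic comparison of real functions down to time 0 *)

Section herbst_real.
Context {R : realType}.
Implicit Types (F phi N : R -> R) (a b c m p t x delta : R).

(* Iterating [F t <= F (t / 2)] pushes [t0] to [0], where [F] is at most [m]. *)
Lemma le_limit_halving F (m c t0 delta : R) : 0 < t0 -> 0 < delta -> 0 <= c ->
  (forall t, 0 < t -> t <= t0 -> F t <= F (t / 2)) ->
  (forall t, 0 < t -> t <= delta -> F t <= m + c * t) ->
  F t0 <= m.
Proof.
move=> t0_gt0 delta_gt0 c_ge0 half small.
have iterF k : F t0 <= F (t0 / 2 ^+ k).
  elim: k => [|k IHk]; first by rewrite expr0 divr1.
  apply: (le_trans IHk); rewrite exprS invfM [_^-1 * _]mulrC mulrA.
  apply: half; first by rewrite divr_gt0// exprn_gt0.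
  by rewrite ler_pdivrMr ?exprn_gt0// ler_peMr// ?exprn_ege1 ?ler1n// ltW.
apply/ler_addgt0Pr => e e0.
(* Below this threshold [small] applies and [c * t <= e]; the [+ 1] covers [c = 0]. *)
have d0 : 0 < Num.min delta (e / (c + 1)).
  by rewrite lt_min delta_gt0 divr_gt0// ltr_wpDl.
have [k Hk] : exists k : nat, t0 / 2 ^+ k <= Num.min delta (e / (c + 1)).
  exists (Num.trunc (t0 / Num.min delta (e / (c + 1)))).+1.
  rewrite ler_pdivrMr ?exprn_gt0// mulrC -ler_pdivrMr//.
  apply: (le_trans (ltW (truncnS_gt _))).
  by rewrite -natrX ler_nat ltnW// ltn_expl.
have s0 : 0 < t0 / 2 ^+ k by rewrite divr_gt0// exprn_gt0.
move: Hk; rewrite le_min => /andP[H1 H2].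
apply: (le_trans (iterF k)); apply: (le_trans (small _ s0 H1)).
rewrite lerD2l; apply: (@le_trans _ _ ((c + 1) * (t0 / 2 ^+ k))).
  by rewrite ler_wpM2r ?ltW// ltrDl.
by rewrite mulrC -ler_pdivlMr// ltr_wpDl.
Qed.

Lemma powR_half t p : 0 <= t -> (t / 2) `^ p = t `^ p * 2 `^ (- p).
Proof.
by move=> t0; rewrite powRM ?invr_ge0// -powR_inv1// -powRrM mulN1r.
Qed.

Lemma pow2N_lt1 p : 0 < p -> (2 : R) `^ (- p) < 1.
Proof.
move=> p0; rewrite powRN invf_lt1 ?powR_gt0//.
rewrite -[X in X < _](_ : 1 `^ p = 1); last by rewrite powR1.
by rewrite gt0_ltr_powR// ?nnegrE ?ltr1n.
Qed.

Section dyadic.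
Variables (a p t0 : R).
Hypotheses (a_gt0 : 0 < a) (p_gt0 : 0 < p) (t0_gt0 : 0 < t0).
Let q : R := 2 `^ (- p).
(** The geometric series [2 * a * (1 + q + q ^ 2 + ...)]: halving [t] lowers [b * t ^ p] by exactly
    [2 * a * t ^ p], which pays for the loss in one comparison step. *)
Let b : R := 2 * a / (1 - q).
Hypothesis b_small : b * t0 `^ p <= 1 / 3.

Let q_lt1 : q < 1. Proof. exact: pow2N_lt1. Qed.
Let q_gt0 : 0 < q. Proof. by rewrite powR_gt0. Qed.
Let b_gt0 : 0 < b. Proof. by rewrite divr_gt0 ?subr_gt0// mulr_gt0. Qed.
Let bq : b * q = b - 2 * a.
Proof. by rewrite /b; field; rewrite subr_eq0 gt_eqF. Qed.
Let aLb : 2 * a <= b.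
Proof. by move: bq (mulr_gt0 b_gt0 q_gt0) => ->; lra. Qed.

Let bt t : 0 < t -> t <= t0 -> 0 <= t `^ p /\ b * t `^ p <= 1 / 3.
Proof.
move=> t_gt0 tt0; split; first exact: powR_ge0.
apply: le_trans b_small; rewrite ler_pM2l//.
by apply: ge0_ler_powR => //; rewrite ?nnegrE; exact: ltW.
Qed.

(** The weight makes [(1 - b * t ^ p) * phi t / t] grow under halving, so [le_limit_halving]
    applies. At [t0] the weight is at least [2 / 3], whence the constant [3 / 2]. *)
Lemma herbst_upper phi m c delta : 0 < delta -> 0 <= c -> 0 <= m ->
  (forall t, 0 < t -> 0 <= phi t) ->
  (forall t, 0 < t -> t <= t0 ->
    (1 - 2 * (a * t `^ p)) * phi t <= 2 * (1 - a * t `^ p) * phi (t / 2)) ->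
  (forall t, 0 < t -> t <= delta -> phi t <= m * t + c * t ^+ 2) ->
  phi t0 <= 3 / 2 * m * t0.
Proof.
move=> delta_gt0 c_ge0 m_ge0 phi_ge0 step small.
have : (1 - b * t0 `^ p) * phi t0 / t0 <= m.
  apply: (@le_limit_halving (fun t => (1 - b * t `^ p) * phi t / t) m c t0
    (Num.min t0 delta)) => // [|t t_gt0 tt0|t t_gt0].
  - by rewrite lt_min t0_gt0.
  - have tE X : X / (t / 2) * t = 2 * X by field; rewrite gt_eqF.
    rewrite ler_pdivrMr// tE.
    have [tau_ge0 btau] := bt t_gt0 tt0.
    have atau : 2 * (a * t `^ p) <= 1 / 3.
      by apply: le_trans btau; rewrite mulrA ler_wpM2r.
    have atau0 : 0 <= a * t `^ p by rewrite mulr_ge0// ltW.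
    have btau0 : 0 <= b * t `^ p by rewrite mulr_ge0// ltW.
    have bqE : b * (t `^ p * q) = b * t `^ p - 2 * (a * t `^ p).
      by rewrite mulrCA bq; ring.
    rewrite (powR_half _ (ltW t_gt0)) -/q bqE.
    have := step t t_gt0 tt0.
    have := phi_ge0 t t_gt0; have t2_gt0 : 0 < t / 2 by rewrite divr_gt0.
    have := phi_ge0 (t / 2) t2_gt0.
    move: atau atau0 btau btau0; set A := a * _; set B := b * _.
    set x := phi _; set y := phi _ => atau atau0 btau btau0 x0 y0 H.
    clearbody A B x y.
    have A1 : 0 < 1 - A by lra.
    rewrite -(ler_pM2l A1).
    apply: (@le_trans _ _ ((1 - (B - 2 * A)) * ((1 - 2 * A) * y))).
      rewrite !mulrA ler_wpM2r//.
      (* The two sides differ by [A + A * B - 4 * A ^ 2], nonnegative because [A <= 1 / 6]. *)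
      have : 0 <= A * B by rewrite mulr_ge0.
      have : 0 <= A * (1 / 3 - 2 * A) by rewrite mulr_ge0// subr_ge0.
      nra.
    apply: (@le_trans _ _ ((1 - (B - 2 * A)) * (2 * (1 - A) * x))).
      by rewrite ler_wpM2l//; lra.
    by rewrite le_eqVlt; apply/orP; left; apply/eqP; ring.
  - rewrite le_min => /andP[tt0 td].
    rewrite ler_pdivrMr// (_ : (m + c * t) * t = m * t + c * t ^+ 2); last by ring.
    apply: le_trans (small t t_gt0 td).
    have [tau_ge0 btau] := bt t_gt0 tt0.
    by rewrite ler_piMl ?phi_ge0// gerBl mulr_ge0// ltW.
rewrite ler_pdivrMr//.
have [tau_ge0 btau] := bt t0_gt0 (lexx _).
have := phi_ge0 t0 t0_gt0.
move: (phi t0) (m * t0) (mulrA (3 / 2) m t0) => x y <-; nra.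
Qed.

(** Mirror image of [herbst_upper]: the weight is now [1 + b * t ^ p], at most [4 / 3] at [t0], and
    the sign is reversed so that [le_limit_halving] yields a lower bound. *)
Lemma herbst_lower N m c delta : 0 < delta -> 0 <= c -> 0 <= m ->
  (forall t, 0 < t -> 0 <= N t) ->
  (forall t, 0 < t -> t <= t0 ->
    2 * (1 + a * t `^ p) * N (t / 2) <= (1 + 2 * (a * t `^ p)) * N t) ->
  (forall t, 0 < t -> t <= delta -> m * t - c * t ^+ 2 <= N t) ->
  m * t0 <= 4 / 3 * N t0.
Proof.
move=> delta_gt0 c_ge0 m_ge0 N_ge0 step small.
have : - ((1 + b * t0 `^ p) * N t0 / t0) <= - m.
  apply: (@le_limit_halving (fun t => - ((1 + b * t `^ p) * N t / t)) (- m) c t0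
    (Num.min t0 delta)) => // [|t t_gt0 tt0|t t_gt0].
  - by rewrite lt_min t0_gt0.
  - have tE X : X / (t / 2) * t = 2 * X by field; rewrite gt_eqF.
    rewrite lerN2 ler_pdivlMr// tE.
    have [tau_ge0 btau] := bt t_gt0 tt0.
    have atau : 2 * (a * t `^ p) <= 1 / 3.
      by apply: le_trans btau; rewrite mulrA ler_wpM2r.
    have atau0 : 0 <= a * t `^ p by rewrite mulr_ge0// ltW.
    have btau0 : 0 <= b * t `^ p by rewrite mulr_ge0// ltW.
    have bqE : b * (t `^ p * q) = b * t `^ p - 2 * (a * t `^ p).
      by rewrite mulrCA bq; ring.
    rewrite (powR_half _ (ltW t_gt0)) -/q bqE.
    have := step t t_gt0 tt0.
    have := N_ge0 t t_gt0; have t2_gt0 : 0 < t / 2 by rewrite divr_gt0.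
    have := N_ge0 (t / 2) t2_gt0.
    have : 2 * (a * t `^ p) <= b * t `^ p by rewrite mulrA ler_wpM2r.
    move: atau atau0 btau btau0; set A := a * _; set B := b * _.
    set x := N _; set y := N _ => atau atau0 btau btau0 AB x0 y0 H.
    clearbody A B x y.
    have A1 : 0 < 1 + A by lra.
    rewrite -(ler_pM2l A1).
    apply: (@le_trans _ _ ((1 + (B - 2 * A)) * ((1 + 2 * A) * y))); last first.
      rewrite !mulrA ler_wpM2r//.
      (* Here the two sides differ by [A - A * B + 4 * A ^ 2], nonnegative because [B <= 1 / 3]. *)
      have : 0 <= A * (1 / 3 - B) by rewrite mulr_ge0// subr_ge0.
      nra.
    apply: (@le_trans _ _ ((1 + (B - 2 * A)) * (2 * (1 + A) * x))); last first.
      by rewrite ler_wpM2l//; lra.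
    by rewrite le_eqVlt; apply/orP; left; apply/eqP; ring.
  - rewrite le_min => /andP[tt0 td].
    rewrite -[leRHS]opprK lerN2 opprD opprK ler_pdivlMr//.
    rewrite (_ : (m - c * t) * t = m * t - c * t ^+ 2); last by ring.
    apply: (le_trans (small t t_gt0 td)).
    have [tau_ge0 btau] := bt t_gt0 tt0.
    by rewrite ler_peMl ?N_ge0// lerDl mulr_ge0// ltW.
rewrite lerN2 ler_pdivlMr//.
have [tau_ge0 btau] := bt t0_gt0 (lexx _).
have := N_ge0 t0 t0_gt0.
move: (N t0) (m * t0) => x y; nra.
Qed.

End dyadic.

End herbst_real.

(** From [1 - x <= expR (- x)] one gets [expR x <= 1 / (1 - x)], and [(1 - x) * (1 + x + 2 * x ^ 2)
    = 1 + x ^ 2 * (1 - 2 * x)] is at least 1. *)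
Lemma expR_le_quadratic {R : realType} (x : R) : `|x| <= 1 / 2 ->
  expR x <= 1 + x + 2 * x ^+ 2.
Proof.
rewrite ler_norml => /andP[x1 x2].
have H : 1 - x <= (expR x)^-1 by rewrite -expRN expR_ge1Dx.
have e0 := expR_gt0 x.
have : (1 - x) * expR x <= 1 by rewrite -ler_pdivlMr// div1r.
have y0 : 0 < 1 - x by lra.
rewrite -ler_pdivlMl// mulr1 => /le_trans; apply.
rewrite -(ler_pM2l y0) mulfV ?gt_eqF//.
have -> : (1 - x) * (1 + x + 2 * x ^+ 2) = 1 + x ^+ 2 * (1 - 2 * x) by ring.
by rewrite lerDl mulr_ge0 ?sqr_ge0//; lra.
Qed.

(** * The moment generating function of a bounded nonnegative function *)

Section herbst_measure.
Context d {T : measurableType d} {R : realType} (mu : probability T R).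
Variables (G : T -> R) (u : R).
Hypotheses (mG : measurable_fun setT G) (G_ge0 : forall x, 0 <= G x)
  (G_le : forall x, G x <= u).
Implicit Types (f g : T -> R) (t : R).

Lemma bounded_integrableT f M : measurable_fun setT f ->
  (forall x, `|f x| <= M) -> mu.-integrable setT (EFin \o f).
Proof.
move=> mf fM; apply: measurable_bounded_integrable => //.
- by apply: le_lt_trans (probability_le1 mu measurableT) _; rewrite ltry.
- exists M; split; first exact: num_real.
  by move=> M' /ltW MM' x _ /=; apply: le_trans MM'.
Qed.

Definition mgf t : R := \int[mu]_x expR (t * G x).
(** Formally the derivative of [mgf]. Instead of differentiating under the integral, the argument
    uses the tangent inequality [ln_mgf_tangent]. *)
Definition mgf' t : R := \int[mu]_x (G x * expR (t * G x)).

Let measurable_exp t : measurable_fun setT (fun x => expR (t * G x)).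
Proof. by apply: measurableT_comp => //; exact: measurable_funM. Qed.

Lemma expRM_le t x : expR (t * G x) <= expR (`|t| * u).
Proof.
rewrite ler_expR; apply: (@le_trans _ _ (`|t| * G x)).
  by rewrite ler_wpM2r// ler_norm.
by rewrite ler_wpM2l.
Qed.

Let int_exp t : mu.-integrable setT (EFin \o (fun x => expR (t * G x))).
Proof.
apply: (@bounded_integrableT _ (expR (`|t| * u))) => // x.
by rewrite ger0_norm ?expR_ge0// expRM_le.
Qed.

Let int_Gexp t : mu.-integrable setT (EFin \o (fun x => G x * expR (t * G x))).
Proof.
apply: (@bounded_integrableT _ (u * expR (`|t| * u))); first exact: measurable_funM.
by move=> x; rewrite ger0_norm ?mulr_ge0 ?expR_ge0// ler_pM ?expR_ge0// expRM_le.
Qed.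

Let int_cst c : mu.-integrable setT (EFin \o (fun _ : T => c)).
Proof. exact: (@bounded_integrableT _ `|c|). Qed.

Let RintC c : \int[mu]_x c = c :> R.
Proof.
transitivity (c * fine (mu setT)); first exact: Rintegral_cst.
by rewrite probability_setT mulr1.
Qed.

Lemma mgf_gt0 t : 0 < mgf t.
Proof.
apply: (@lt_le_trans _ _ (expR (- (`|t| * u)))); first exact: expR_gt0.
rewrite -[leLHS]RintC; apply: le_Rintegral => // x _.
rewrite ler_expR lerNl -mulNr; apply: (@le_trans _ _ (`|t| * G x)).
  by rewrite ler_wpM2r// -normrN ler_norm.
by rewrite ler_wpM2l.
Qed.

Lemma mgf'_ge0 t : 0 <= mgf' t.
Proof. by apply: Rintegral_ge0 => x _; rewrite mulr_ge0 ?expR_ge0. Qed.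

Lemma mgf_ge1 t : 0 <= t -> 1 <= mgf t.
Proof.
move=> t0; rewrite -[leLHS]RintC; apply: le_Rintegral => // x _.
by rewrite -expR0 ler_expR mulr_ge0.
Qed.

Lemma mgf_le1 t : t <= 0 -> mgf t <= 1.
Proof.
move=> t0; rewrite -[leRHS]RintC; apply: le_Rintegral => // x _.
by rewrite -expR0 ler_expR mulr_le0_ge0.
Qed.

(* Convexity of [ln mgf]: its tangent at [t], whose slope is [mgf' t / mgf t], evaluated at [t / 2]. *)
Lemma ln_mgf_tangent t :
  ln (mgf t) - t * mgf' t / mgf t / 2 <= ln (mgf (t / 2)).
Proof.
have La0 := mgf_gt0 t.
set c := t * mgf' t / mgf t / 2.
have cE : c * mgf t = t / 2 * mgf' t by rewrite /c; field; rewrite gt_eqF.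
(* By the choice of [c], [(c - t / 2 * G) * expR (t * G)] integrates to 0; so integrating [1 + c - t
   / 2 * G <= expR (c - t / 2 * G)] against [expR (t * G)] gives the claim. *)
suff H : expR (- c) * mgf t <= mgf (t / 2).
  move: H; rewrite -ler_ln ?posrE ?mulr_gt0 ?expR_gt0 ?mgf_gt0//.
  by rewrite lnM ?posrE ?expR_gt0// expRK addrC.
have -> : expR (- c) * mgf t
    = expR (- c) * ((1 + c) * mgf t - t / 2 * mgf' t) by rewrite -cE; ring.
rewrite -!RintegralZl// -RintegralB//; last 2 first.
- exact: (@integrableZl _ _ _ mu _ measurableT (1 + c) _ (int_exp t)).
- exact: (@integrableZl _ _ _ mu _ measurableT (t / 2) _ (int_Gexp t)).
have i1 : mu.-integrable setT (EFin \o (fun x =>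
    (1 + c) * expR (t * G x) - t / 2 * (G x * expR (t * G x)))).
  apply: (@integrableB _ _ _ mu _ measurableT (EFin \o (fun x => (1 + c) * expR (t * G x)))
     (EFin \o (fun x => t / 2 * (G x * expR (t * G x))))).
  - exact: (@integrableZl _ _ _ mu _ measurableT (1 + c) _ (int_exp t)).
  - exact: (@integrableZl _ _ _ mu _ measurableT (t / 2) _ (int_Gexp t)).
rewrite -RintegralZl//; apply: le_Rintegral => //.
  exact: (@integrableZl _ _ _ mu _ measurableT (expR (- c)) _ i1).
move=> x _.
have E0 := expR_gt0 (t * G x).
have -> : expR (t / 2 * G x) = expR (- c) * (expR (t * G x) * expR (c - t / 2 * G x)).
  by rewrite -!expRD; congr expR; field.
rewrite ler_wpM2l ?expR_ge0//.
have -> : (1 + c) * expR (t * G x) - t / 2 * (G x * expR (t * G x))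
  = expR (t * G x) * (1 + (c - t / 2 * G x)) by ring.
by rewrite ler_wpM2l ?expR_ge0// expR_ge1Dx.
Qed.

(** The smallness of [s] gives [|s * G x| <= 1 / 2], so [expR_le_quadratic] holds pointwise. This is
    the behaviour near 0, with slope the mean of [G], at which the halving iterations stop. *)
Lemma mgf_le_quadratic s : `|s| * (2 * (u + 1)) <= 1 ->
  mgf s <= 1 + (\int[mu]_x G x) * s + 2 * u ^+ 2 * s ^+ 2.
Proof.
move=> su.
have u1 : 0 <= u by exact: le_trans (G_ge0 point) (G_le point).
have iG : mu.-integrable setT (EFin \o G).
  by apply: (@bounded_integrableT _ u) => // x; rewrite ger0_norm.
have isG : mu.-integrable setT (EFin \o (fun x => s * G x)).
  exact: (@integrableZl _ _ _ mu _ measurableT s _ iG).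
have i1 : mu.-integrable setT (EFin \o (fun x => 1 + s * G x)).
  exact: (@integrableD _ _ _ mu _ measurableT (EFin \o cst 1) _ (int_cst 1) isG).
have i2 : mu.-integrable setT (EFin \o (fun x => 1 + s * G x + 2 * u ^+ 2 * s ^+ 2)).
  exact: (@integrableD _ _ _ mu _ measurableT _ (EFin \o cst (2 * u ^+ 2 * s ^+ 2)) i1 (int_cst _)).
apply: (@le_trans _ _ (\int[mu]_x (1 + s * G x + 2 * u ^+ 2 * s ^+ 2))); last first.
  by rewrite RintegralD// RintegralD// !RintC RintegralZl// [s * _]mulrC.
apply: le_Rintegral => // x _.
have sG : `|s * G x| <= `|s| * u.
  by rewrite normrM ler_wpM2l// ger0_norm.
apply: le_trans (expR_le_quadratic _) _.
  apply: (le_trans sG); have := normr_ge0 s; nra.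
rewrite lerD2l -mulrA ler_wpM2l// -exprMn -real_normK ?num_real//.
rewrite -[leRHS]real_normK ?num_real// lerXn2r ?nnegrE//.
by rewrite [leRHS]normrM (ger0_norm u1) [u * _]mulrC.
Qed.

Lemma mgf_half_measure (A : set T) t : 0 <= t -> measurable A ->
  ((1 / 2)%:E <= mu A)%E -> (forall x, A x -> G x = 0) -> 1 / 2 <= mgf (- t).
Proof.
move=> t0 mA muA GA.
have fA : mu A \is a fin_num by exact: fin_num_measure.
apply: (@le_trans _ _ (\int[mu]_x (\1_A x : R))).
  by rewrite /Rintegral integral_indic// setIT -lee_fin fineK.
apply: le_Rintegral => //; first exact: integrable_indic.
move=> x _; rewrite indicE; case: (boolP (x \in A)) => [|_]; last exact: expR_ge0.
by rewrite inE => /GA ->; rewrite mulr0 expR0.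
Qed.

Let measurable_ge : measurable [set x | u <= G x].
Proof.
rewrite -[X in measurable X]setTI.
have -> : [set x | u <= G x] = G @^-1` [set` `[u, +oo[].
  by apply/seteqP; split => x; rewrite /= in_itv/= andbT.
exact: mG.
Qed.

Lemma mgf_markov t : 0 <= t ->
  (mu [set x | (u <= G x)%R] <= (mgf t * expR (- (t * u)))%:E)%E.
Proof.
move=> t0.
have fA : mu [set x | u <= G x] \is a fin_num by exact: fin_num_measure.
rewrite -[leLHS]fineK// lee_fin expRN ler_pdivlMr ?expR_gt0//.
have -> : fine (mu [set x | u <= G x]) = \int[mu]_x (\1_[set x | u <= G x] x : R).
  by rewrite /Rintegral integral_indic// setIT.
have iA : mu.-integrable setT (EFin \o (\1_[set x | u <= G x] : T -> R)).
  exact: integrable_indic.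
rewrite -RintegralZr//; apply: le_Rintegral => //.
  exact: (@integrableZr _ _ _ mu _ measurableT (expR (t * u)) _ iA).
move=> x _; rewrite indicE; case: (boolP (x \in _)) => [|_]; last first.
  by rewrite mul0r expR_ge0.
by rewrite inE /= => ux; rewrite mul1r ler_expR ler_wpM2l.
Qed.

(** * Herbst's argument: from the inequality for [mgf] to concentration *)

Section concentration.
Variables (a p t0 : R).
Hypotheses (a_gt0 : 0 < a) (p_gt0 : 0 < p) (t0_gt0 : 0 < t0)
  (t0_small : 2 * a / (1 - 2 `^ (- p)) * t0 `^ p <= 1 / 3).
Hypothesis lsi : forall t, `|t| <= t0 ->
  t * mgf' t - mgf t * ln (mgf t) <= a * `|t| `^ (1 + p) * mgf' t.

Let at1 t : 0 < t -> t <= t0 -> 0 <= a * t `^ p <= 1 / 6.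
Proof.
move=> t_gt0 tt0.
rewrite mulr_ge0 ?powR_ge0 ?(ltW a_gt0)//=.
have q1 := pow2N_lt1 p_gt0; have q0 : 0 < (2 : R) `^ (- p) by rewrite powR_gt0.
have : a * t `^ p <= a * t0 `^ p.
  rewrite ler_pM2l//; apply: ge0_ler_powR => //; rewrite ?nnegrE; exact: ltW.
have : 2 * (a * t0 `^ p) <= 1 / 3.
  (* The factor [1 / (1 - 2 ^ (- p))] in [t0_small] is at least 1 and may be dropped. *)
  apply: le_trans t0_small.
  rewrite mulrA ler_wpM2r ?powR_ge0// ler_peMr ?mulr_ge0 ?(ltW a_gt0)//.
  by rewrite invf_ge1 ?subr_gt0// gerBl ltW.
move: (a * t `^ p) (a * t0 `^ p) => x y; lra.
Qed.

Let lsi_pos t : 0 < t -> t <= t0 ->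
  t * mgf' t / mgf t * (1 - a * t `^ p) <= ln (mgf t).
Proof.
move=> t_gt0 tt0; have La0 := mgf_gt0 t.
have := @lsi t; rewrite gtr0_norm// => /(_ tt0).
rewrite powRD ?(gt_eqF t_gt0) ?implybT// powRr1 ?(ltW t_gt0)// => H.
have -> : t * mgf' t / mgf t * (1 - a * t `^ p)
  = (t * mgf' t - a * (t * t `^ p) * mgf' t) / mgf t by ring.
by rewrite ler_pdivrMr// [ln _ * _]mulrC; lra.
Qed.

(** At [- t] the term [t * mgf'] changes sign while the error term does not, so the slope bounds
    [- ln mgf] from above, with factor [1 + a * t ^ p]. *)
Let lsi_neg t : 0 < t -> t <= t0 ->
  - ln (mgf (- t)) <= (t * mgf' (- t) / mgf (- t)) * (1 + a * t `^ p).
Proof.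
move=> t_gt0 tt0; have La0 := mgf_gt0 (- t).
have := @lsi (- t); rewrite normrN gtr0_norm// => /(_ tt0).
rewrite powRD ?(gt_eqF t_gt0) ?implybT// powRr1 ?(ltW t_gt0)// => H.
have -> : t * mgf' (- t) / mgf (- t) * (1 + a * t `^ p)
  = (t * mgf' (- t) + a * (t * t `^ p) * mgf' (- t)) / mgf (- t) by ring.
by rewrite ler_pdivlMr// mulNr [ln _ * _]mulrC; lra.
Qed.

(** The mean of [G] is eliminated between the bounds at [t0] and [- t0]. Their constants multiply to
    [3 / 2 * (4 / 3) = 2], so [ln (mgf t0) <= 2 * ln 2]. *)
Lemma mgf_le4 (A : set T) : measurable A -> ((1 / 2)%:E <= mu A)%E ->
  (forall x, A x -> G x = 0) -> mgf t0 <= 4.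
Proof.
move=> mA muA GA.
have u0 : 0 <= u by exact: le_trans (G_ge0 point) (G_le point).
have m0 : 0 <= \int[mu]_x G x by apply: Rintegral_ge0.
have delta0 : 0 < (2 * (u + 1))^-1.
  by rewrite invr_gt0 mulr_gt0// ltr_wpDl.
have c0 : 0 <= 2 * u ^+ 2 by rewrite mulr_ge0// sqr_ge0.
have small s : `|s| <= (2 * (u + 1))^-1 ->
    mgf s <= 1 + (\int[mu]_x G x) * s + 2 * u ^+ 2 * s ^+ 2.
  move=> hs; apply: mgf_le_quadratic.
  by rewrite -ler_pdivlMr ?div1r// mulr_gt0// ltr_wpDl.
have upper : ln (mgf t0) <= 3 / 2 * (\int[mu]_x G x) * t0.
  apply: (herbst_upper a_gt0 p_gt0 t0_gt0 t0_small (phi := fun t => ln (mgf t))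
    delta0 c0 m0) => [t t_gt0|t t_gt0 tt0|t t_gt0 td].
  - by rewrite ln_ge0// mgf_ge1// ltW.
  - rewrite /=; have /andP[A0 A6] := at1 t_gt0 tt0.
    move: (lsi_pos t_gt0 tt0) (ln_mgf_tangent t).
    move: (a * t `^ p) (t * mgf' t / mgf t) (ln _) (ln _) A0 A6 => B X x y A0 A6 lsi_t tangent.
    (* The tangent inequality, weighted by [1 - B], lets the log-Sobolev bound eliminate the slope
       [X]. *)
    have : 0 <= (1 - B) * (x - (y - X / 2)) by apply: mulr_ge0; lra.
    lra.
  - apply: (@le_trans _ _ (mgf t - 1)); last first.
      by have := small t; rewrite gtr0_norm// => /(_ td); lra.
    by rewrite -[X in ln X](subrK 1) addrC le_ln1Dx// ltrBDl subrr mgf_gt0.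
have lower : (\int[mu]_x G x) * t0 <= 4 / 3 * - ln (mgf (- t0)).
  apply: (herbst_lower a_gt0 p_gt0 t0_gt0 t0_small (N := fun t => - ln (mgf (- t)))
    delta0 c0 m0) => [t t_gt0|t t_gt0 tt0|t t_gt0 td].
  - by rewrite oppr_ge0 ln_le0// mgf_le1// oppr_le0 ltW.
  - rewrite /=; have /andP[A0 A6] := at1 t_gt0 tt0.
    move: (lsi_neg t_gt0 tt0) (ln_mgf_tangent (- t)); rewrite !mulNr opprK.
    move: (a * t `^ p) (t * mgf' (- t) / mgf (- t)) (ln _) (ln _) A0 A6 => B X x y A0 A6 lsi_t tangent.
    have : 0 <= (1 + B) * (x - (y + X / 2)) by apply: mulr_ge0; lra.
    lra.
  - apply: (@le_trans _ _ (1 - mgf (- t))).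
      by have := small (- t); rewrite normrN gtr0_norm// sqrrN => /(_ td); lra.
    rewrite lerNr opprB -[X in ln X](subrK 1) addrC le_ln1Dx//.
    by rewrite ltrBDl subrr mgf_gt0.
have half := mgf_half_measure (ltW t0_gt0) mA muA GA.
have : - ln (mgf (- t0)) <= ln 2.
  rewrite lerNl -lnV ?posrE// ler_ln ?posrE ?mgf_gt0// ?invr_gt0//.
  by rewrite -div1r.
have : ln 4 = ln 2 + ln 2 :> R by rewrite -lnM ?posrE// -natrM.
rewrite -ler_ln ?posrE ?mgf_gt0//; lra.
Qed.

Lemma herbst_concentration (A : set T) : measurable A ->
  ((1 / 2)%:E <= mu A)%E -> (forall x, A x -> G x = 0) ->
  ((1 - 4 * expR (- (t0 * u)))%:E <= mu [set x | (G x < u)%R])%E.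
Proof.
move=> mA muA GA.
have -> : [set x | G x < u] = ~` [set x | u <= G x].
  by apply/seteqP; split => x /=; rewrite ltNge => /negP.
rewrite probability_setC//.
rewrite EFinB leeB//; apply: le_trans (mgf_markov (ltW t0_gt0)) _.
by rewrite lee_fin ler_wpM2r ?expR_ge0// (mgf_le4 mA).
Qed.

End concentration.
End herbst_measure.

(** * The dot product and the sup norm *)

Section dot_product.
Context {R : realType} {n : nat}.
Implicit Types (x y z w : 'rV[R]_n) (a : R).

Lemma dotvC x y : dotv x y = dotv y x.
Proof. by apply: eq_bigr => i _; rewrite mulrC. Qed.

Lemma dotvDr x y z : dotv x (y + z) = dotv x y + dotv x z.
Proof. by rewrite /dotv -big_split; apply: eq_bigr => i _; rewrite mxE mulrDr. Qed.

Lemma dotvZr a x y : dotv x (a *: y) = a * dotv x y.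
Proof. by rewrite /dotv mulr_sumr; apply: eq_bigr => i _; rewrite mxE mulrCA. Qed.

Lemma dotvBr x y z : dotv x (y - z) = dotv x y - dotv x z.
Proof. by rewrite dotvDr -scaleN1r dotvZr mulN1r. Qed.

Lemma dotvDl x y z : dotv (x + y) z = dotv x z + dotv y z.
Proof. by rewrite dotvC dotvDr !(dotvC z). Qed.

Lemma dotvZl a x y : dotv (a *: x) y = a * dotv x y.
Proof. by rewrite dotvC dotvZr dotvC. Qed.

Lemma dotv0 x : dotv x 0 = 0.
Proof. by rewrite -(scale0r 0) dotvZr mul0r. Qed.

Lemma dotv_delta x (i : 'I_n) : dotv x (delta_mx 0 i) = x 0 i.
Proof.
rewrite /dotv (bigD1 i)//= big1 ?addr0 ?mxE ?eqxx ?mulr1// => j ji.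
by rewrite mxE (negbTE ji) andbF mulr0.
Qed.

Lemma dotvv_eq0 x : dotv x x <= 0 -> x = 0.
Proof.
move=> xx; have /eqP : dotv x x = 0.
  by apply/eqP; rewrite eq_le xx sumr_ge0// => i _; rewrite -expr2 sqr_ge0.
rewrite psumr_eq0 => [/allP xx0|i _]; last by rewrite -expr2 sqr_ge0.
apply/rowP => i; rewrite mxE.
by have := xx0 i (mem_index_enum _); rewrite /= mulf_eq0 orbb => /eqP.
Qed.

Lemma coord_le_norm x (i : 'I_n) : `|x 0 i| <= `|x|.
Proof. by rewrite [leRHS]/Num.norm /= mx_normrE; apply/bigmax_geP; right => /=; exists (0, i). Qed.

Lemma norm_le_coord x (M : R) : 0 <= M -> (forall i, `|x 0 i| <= M) -> `|x| <= M.
Proof.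
move=> M0 xM; rewrite [leLHS]/Num.norm /= mx_normrE; apply/bigmax_leP; split => //.
by move=> [i j] _ /=; rewrite ord1.
Qed.

(** The sup norm bounds each of the [n] products separately, which is where the factor [n] comes
    from. *)
Lemma dotv_le_norm x y : dotv x y <= n%:R * `|x| * `|y|.
Proof.
rewrite -mulrA mulr_natl -[X in _ *+ X]card_ord -sumr_const.
apply: ler_sum => i _; apply: le_trans (ler_norm _) _.
by rewrite normrM ler_pM// coord_le_norm.
Qed.

End dot_product.

(** * Subgradients of finite convex functions *)

Section subgradient.
Context {R : realType} {n : nat}.
Implicit Types (h : 'rV[R]_n -> R) (x y w v : 'rV[R]_n).

Definition convexR h := forall (s : R) x y, 0 <= s -> s <= 1 ->
  h (s *: x + (1 - s) *: y) <= s * h x + (1 - s) * h y.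

(* Finite-dimensional Hahn-Banach: the minorant is extended one coordinate at a time. *)
Lemma linear_minorant_prefix h k : convexR h -> h 0 = 0 ->
  exists w, forall y, (forall i : 'I_n, (k <= i)%N -> y 0 i = 0) -> dotv w y <= h y.
Proof.
move=> convh h0; elim: k => [|k [w wh]].
  exists 0 => y y0; have -> : y = 0 by apply/rowP => i; rewrite y0// mxE.
  by rewrite dotv0 h0.
have [kn|nk] := ltnP k n; last first.
  by exists w => y _; apply: wh => i ki; have := leq_trans nk ki; rewrite leqNgt ltn_ord.
pose i0 := Ordinal kn; pose e : 'rV[R]_n := delta_mx 0 i0.
pose V y := forall i : 'I_n, (k <= i)%N -> y 0 i = 0.
pose g y := h y - dotv w y.
have g_ge0 y : V y -> 0 <= g y by move=> Vy; rewrite subr_ge0 wh.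
have gconv s x y : 0 <= s -> s <= 1 ->
    g (s *: x + (1 - s) *: y) <= s * g x + (1 - s) * g y.
  move=> s0 s1; have := convh s x y s0 s1.
  by rewrite /g dotvDr !dotvZr; lra.
(* The weights [r / (r + s)] and [s / (r + s)] cancel the [e] components, so the convex combination
   falls in [V], where [g] is nonnegative. *)
have cross y1 y2 (s r : R) : V y1 -> V y2 -> 0 < s -> 0 < r ->
    - g (y1 - s *: e) / s <= g (y2 + r *: e) / r.
  move=> V1 V2 s0 r0.
  have sr0 : 0 < r + s by rewrite addr_gt0.
  have sE : 1 - r / (r + s) = s / (r + s) by field; rewrite gt_eqF.
  have t0 : 0 <= r / (r + s) by rewrite divr_ge0 ?ltW.
  have t1 : r / (r + s) <= 1 by rewrite ler_pdivrMr// mul1r lerDl ltW.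
  have := gconv _ (y1 - s *: e) (y2 + r *: e) t0 t1; rewrite sE.
  have : 0 <= g (r / (r + s) *: (y1 - s *: e) + s / (r + s) *: (y2 + r *: e)).
    apply: g_ge0 => i ki; have := V1 i ki; have := V2 i ki; rewrite !mxE => -> ->.
    by ring.
  move=> /le_trans /[apply].
  have -> : r / (r + s) * g (y1 - s *: e) + s / (r + s) * g (y2 + r *: e) =
     (r * g (y1 - s *: e) + s * g (y2 + r *: e)) / (r + s) by ring.
  rewrite pmulr_lge0 ?invr_gt0// => H.
  rewrite ler_pdivrMr// mulrAC ler_pdivlMr//; lra.
(* [S] collects the lower bounds that points below [V] impose on the coefficient along [e]; by
   [cross], points above [V] bound [S] from above, so [sup S] meets both kinds of constraint. *)
pose S := [set - g (y.1 - y.2 *: e) / y.2 | y in [set y : 'rV[R]_n * R | V y.1 /\ 0 < y.2]].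
have V0 : V 0 by move=> i _; rewrite mxE.
have supS : has_sup S.
  split; first by exists (- g (0 - 1 *: e) / 1); exists (0, 1).
  exists (g (0 + 1 *: e) / 1) => _ [[y s] [/= Vy s0] <-].
  exact: cross.
exists (w + sup S *: e) => y Vy.
pose s := y 0 i0.
have V1 : V (y - s *: e).
  move=> i; rewrite leq_eqVlt => /orP[/eqP ki|ki].
    have -> : i = i0 by apply/val_inj.
    by rewrite !mxE !eqxx mulr1 subrr.
  rewrite !mxE (Vy _ ki); have /negbTE -> : i != i0.
    by apply/eqP => ii; move: ki; rewrite ii ltnn.
  by rewrite andbF mulr0 subr0.
have yE : y = (y - s *: e) + s *: e by rewrite subrK.
rewrite dotvDl dotvZl -lerBrDl [dotv e y]dotvC dotv_delta -/s.
suff : sup S * s <= g y by [].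
have [s0|s0|s0] := ltgtP s 0.
- rewrite -ler_ndivrMr//.
  apply: (ub_le_sup (proj2 supS)); exists (y - s *: e, - s).
    by split => //=; rewrite oppr_gt0.
  have -> : y - s *: e - (- s) *: e = y by apply/rowP => j; rewrite !mxE; ring.
  by rewrite invrN mulrNN.
- rewrite -ler_pdivlMr//; apply: (ge_sup (proj1 supS)) => _ [[z r] [/= Vz r0] <-].
  by rewrite {1}yE; exact: cross.
- by rewrite s0 mulr0; apply: g_ge0; move: V1; rewrite s0 scale0r subr0.
Qed.

(** Translate [v] and its value to the origin; for [k = n] the support condition of
    [linear_minorant_prefix] is vacuous. *)
Lemma subgradient_exists h v : convexR h ->
  exists w, forall y, dotv w (y - v) <= h y - h v.
Proof.
move=> convh; have cg : convexR (fun y => h (v + y) - h v).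
  move=> s x y s0 s1; have := convh s (v + x) (v + y) s0 s1.
  have -> : s *: (v + x) + (1 - s) *: (v + y) = v + (s *: x + (1 - s) *: y).
    by apply/rowP => i; rewrite !mxE; ring.
  lra.
have [|w wP] := linear_minorant_prefix n cg; first by rewrite addr0 subrr.
exists w => y; have := wP (y - v); rewrite [v + _]addrC subrK; apply => i.
by rewrite leqNgt ltn_ord.
Qed.

End subgradient.

(** * The Legendre transform under the growth condition *)

Section conjugate.
Context {R : realType} {n : nat}.
Variables (Psi : 'rV[R]_n -> R) (K alpha delta rho : R).
Hypotheses (alpha_gt1 : 1 < alpha) (K_ge1 : 1 <= K).
Hypotheses (Psi_ge0 : forall x, 0 <= Psi x) (Psi0 : Psi 0 = 0).
Hypothesis Psi_growth : forall t x, 1 <= t -> K^-1 * t `^ alpha * Psi x <= Psi (t *: x).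
Hypotheses (delta_gt0 : 0 < delta) (Psi_small : forall x : 'rV[R]_n, `|x| <= delta -> Psi x <= 1).
Hypotheses (rho_gt0 : 0 < rho) (Psi_large : forall x : 'rV[R]_n, rho <= `|x| -> 1 <= Psi x).
Implicit Types (x y z w v : 'rV[R]_n) (t s B u : R).

Let p := alpha - 1.
Let p_gt0 : 0 < p. Proof. by rewrite subr_gt0. Qed.
Let K_gt0 : 0 < K. Proof. exact: lt_le_trans ltr01 K_ge1. Qed.

Let growth_mul t x : 1 <= t -> K^-1 * t `^ p * t * Psi x <= Psi (t *: x).
Proof.
move=> t1; apply: le_trans (Psi_growth x t1).
have t0 : 0 < t by exact: lt_le_trans ltr01 t1.
by rewrite -[t `^ alpha]mulr_powRB1 ?(ltW t0) ?(lt_trans ltr01)// [t * _]mulrC !mulrA.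
Qed.

(** Write [y] as [s] times a vector of norm [rho], where [Psi] is at least 1: growth gives
    [Psi y >= K^-1 * s ^ p * s], and [s ^ p] exceeds any bound since [alpha > 1]. *)
Lemma Psi_superlinear B : 0 <= B ->
  exists2 r, 0 <= r & forall y, r <= `|y| -> B * `|y| <= Psi y.
Proof.
move=> B0; pose t := Num.max 1 ((K * (B * rho)) `^ p^-1).
have t1 : 1 <= t by rewrite le_max lexx.
have tp : B * rho <= K^-1 * t `^ p.
  rewrite ler_pdivlMl//.
  have KB0 : 0 <= K * (B * rho) by rewrite !mulr_ge0// ltW.
  have -> : K * (B * rho) = ((K * (B * rho)) `^ p^-1) `^ p.
    by rewrite -powRrM mulVf ?gt_eqF// powRr1.
  apply: ge0_ler_powR; rewrite ?nnegrE ?powR_ge0//; first exact: ltW.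
    exact: le_trans t1.
  by rewrite le_max lexx orbT.
exists (rho * t); first by rewrite mulr_ge0 ?(ltW rho_gt0)// (le_trans ler01).
move=> y; rewrite mulrC -ler_pdivlMr// => ty.
set s := `|y| / rho in ty.
have s1 := le_trans t1 ty; have s0 := lt_le_trans ltr01 s1.
have yE : y = s *: (s^-1 *: y) by rewrite scalerA mulfV ?gt_eqF// scale1r.
have y1 : 1 <= Psi (s^-1 *: y).
  apply: Psi_large; rewrite normrZ gtr0_norm ?invr_gt0// /s invf_div mulrVK//.
  rewrite unitfE; apply/eqP => y0; move: s0; rewrite /s y0 mul0r ltxx//.
rewrite [in leRHS]yE.
apply: le_trans (growth_mul _ s1).
have -> : B * `|y| = B * rho * s * 1 by rewrite /s; field; rewrite gt_eqF.
apply: ler_pM => //; first exact: mulr_ge0 (mulr_ge0 B0 (ltW rho_gt0)) (ltW s0).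
rewrite ler_wpM2r ?(ltW s0)//; apply: (le_trans tp).
rewrite ler_pM2l ?invr_gt0//; apply: ge0_ler_powR => //; rewrite ?nnegrE ?(ltW s0)//.
  exact: ltW.
exact: le_trans t1.
Qed.

(** [fine] loses nothing: [legendreE] shows that the supremum is finite. *)
Definition conjugate x : R := fine (legendre (EFin \o Psi) x).

(** By superlinearity, only [y] in a bounded ball can contribute a positive value to the supremum;
    [y = 0] contributes 0. *)
Lemma legendreE x : legendre (EFin \o Psi) x = (conjugate x)%:E.
Proof.
have [r r0 rP] := @Psi_superlinear (n%:R * `|x|) (mulr_ge0 (ler0n _ _) (normr_ge0 _)).
rewrite /conjugate fineK// fin_real//; apply/andP; split.
  apply: (@lt_le_trans _ _ 0%E); first exact: ltNyr.
  by apply: ereal_sup_ubound; exists 0 => //=; rewrite dotv0 Psi0 sube0.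
apply: (@le_lt_trans _ _ (n%:R * `|x| * r)%:E); last exact: ltry.
apply: ge_ereal_sup => _ [y _ <-] /=; rewrite -EFinB lee_fin.
have xy := dotv_le_norm x y.
have [yr|/ltW ry] := leP `|y| r.
  rewrite lerBlDr ler_wpDr//; apply: (le_trans xy).
  by rewrite ler_wpM2l// mulr_ge0.
apply: (@le_trans _ _ 0); last by rewrite !mulr_ge0.
by rewrite subr_le0 (le_trans xy)// rP.
Qed.

Lemma le_conj x y : dotv x y - Psi y <= conjugate x.
Proof.
by rewrite -lee_fin -legendreE; apply: ereal_sup_ubound; exists y.
Qed.

Lemma conj_le x c : (forall y, dotv x y - Psi y <= c) -> conjugate x <= c.
Proof.
move=> H; rewrite -lee_fin -legendreE; apply: ge_ereal_sup => _ [y _ <-] /=.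
by rewrite -EFinB lee_fin.
Qed.

Lemma conj_ge0 x : 0 <= conjugate x.
Proof. by have := le_conj x 0; rewrite dotv0 Psi0 subr0. Qed.

Lemma conj0 : conjugate 0 = 0.
Proof.
apply/eqP; rewrite eq_le conj_ge0 andbT; apply: conj_le => y.
by rewrite dotvC dotv0 sub0r oppr_le0.
Qed.

Lemma conj_convex : convexR conjugate.
Proof.
move=> s x y s0 s1; apply: conj_le => z.
have := le_conj x z; have := le_conj y z; rewrite dotvDl !dotvZl => H1 H2.
have : 0 <= s * (conjugate x - (dotv x z - Psi z)) by rewrite mulr_ge0 ?subr_ge0.
have : 0 <= (1 - s) * (conjugate y - (dotv y z - Psi z)) by rewrite mulr_ge0 ?subr_ge0.
lra.
Qed.

(** Twice the factor [t] for which [K^-1 * t ^ p = 2], that is, for which growth yields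
    [Psi (t *: y) >= 2 * t * Psi y]. *)
Definition doubling : R := 2 * (2 * K) `^ p^-1.

Lemma doubling_ge2 : 2 <= doubling.
Proof.
rewrite ler_peMr// -[leLHS](_ : 1 `^ p^-1 = 1); last by rewrite powR1.
by apply: ge0_ler_powR; rewrite ?nnegrE ?invr_ge0 ?(ltW p_gt0)//; have := K_ge1; lra.
Qed.

(** Substituting [y = t *: y'] bounds each competitor by [2 * t * (dotv z y' - Psi y')], and [2 * t]
    is [doubling]. *)
Lemma conj_doubling z : conjugate (2 *: z) <= doubling * conjugate z.
Proof.
apply: conj_le => y; pose t := (2 * K) `^ p^-1.
have t1 : 1 <= t.
  by have := doubling_ge2; rewrite /doubling -/t; lra.
have t0 := lt_le_trans ltr01 t1.
have tp : t `^ p = 2 * K.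
  rewrite -powRrM mulVf ?gt_eqF// powRr1// mulr_ge0//; exact: ltW.
pose y' := t^-1 *: y.
have -> : y = t *: y' by rewrite scalerA mulfV ?gt_eqF// scale1r.
have := growth_mul y' t1; rewrite tp.
have -> : K^-1 * (2 * K) * t * Psi y' = 2 * t * Psi y' by field; rewrite gt_eqF.
rewrite dotvZl dotvZr /doubling -/t => H.
have : 0 <= 2 * t * (conjugate z - (dotv z y' - Psi y')).
  by rewrite mulr_ge0 ?subr_ge0 ?le_conj// mulr_ge0// ltW.
lra.
Qed.

(** Testing the supremum at [delta] times a signed unit vector, where [Psi <= 1], controls each
    coordinate. Sublevel sets of the conjugate are therefore bounded. *)
Lemma conj_coercive x : delta * `|x| <= conjugate x + 1.
Proof.
rewrite mulrC -ler_pdivlMr//; apply: norm_le_coord => [|i].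
  by rewrite divr_ge0 ?(ltW delta_gt0)// addr_ge0// conj_ge0.
rewrite ler_pdivlMr//.
pose y : 'rV[R]_n := (delta * Num.sg (x 0 i)) *: delta_mx 0 i.
have yd : `|y| <= delta.
  apply: norm_le_coord => [|j]; first exact: ltW.
  rewrite !mxE eqxx /= normrM normrM (gtr0_norm delta_gt0) normr_sg.
  by rewrite -mulrA ler_piMr ?(ltW delta_gt0)//; case: (_ != _); case: (_ == _);
    rewrite ?mulr1 ?mul1r ?mul0r ?mulr0 ?normr1 ?normr0.
have := le_conj x y; rewrite dotvZr dotv_delta -mulrA -normrEsg.
by have := Psi_small yd; lra.
Qed.

(** For [|x| <= r], points [y] outside one fixed ball contribute at most 0; inside it, [dotv x y] is
    Lipschitz in [x] uniformly in [y]. No bound on [x'] is required. *)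
Lemma conj_lipschitz_ball (r : R) : 0 <= r ->
  exists2 M, 0 <= M & forall x x', `|x| <= r -> conjugate x <= conjugate x' + M * `|x - x'|.
Proof.
move=> r0.
have [r' r'0 r'P] := @Psi_superlinear (n%:R * r) (mulr_ge0 (ler0n _ _) r0).
exists (n%:R * r'); first exact: mulr_ge0.
move=> x x' xr; apply: conj_le => y.
have [yr|/ltW ry] := leP `|y| r'.
  have -> : dotv x y = dotv x' y + dotv (x - x') y by rewrite -dotvDl addrC subrK.
  have : dotv (x - x') y <= n%:R * r' * `|x - x'|.
    apply: le_trans (dotv_le_norm _ _) _.
    by rewrite -!mulrA ler_wpM2l// mulrC ler_wpM2r.
  by have := le_conj x' y; lra.
apply: (@le_trans _ _ 0).
  rewrite subr_le0 (le_trans (dotv_le_norm _ _))// (le_trans _ (r'P _ ry))//.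
  by rewrite ler_wpM2r// ler_wpM2l.
by rewrite addr_ge0 ?conj_ge0// !mulr_ge0.
Qed.

End conjugate.

(** * Gradients: first-order expansion, default value, maxima *)

Section gradient_facts.
Context {R : realType} {n : nat}.
Implicit Types (f : 'rV[R]_n -> R) (x h v : 'rV[R]_n).

Lemma diff_dotv f x h : ('d f x : 'rV[R]_n -> R) h = dotv (gradient f x) h.
Proof.
rewrite {1}(row_sum_delta h) linear_sum; apply: eq_bigr => i _.
by rewrite linearZ mxE mulrC.
Qed.

Lemma differentiable_gradientP f x (e : R) : differentiable f x -> 0 < e ->
  exists2 d, 0 < d & forall h, `|h| < d ->
    `|f (x + h) - f x - dotv (gradient f x) h| <= e * `|h|.
Proof.
move=> /diff_locally/eqaddoP df e0.
have /nbhs_normP[d /= d0 dP] := df e e0.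
exists d => // h hd.
have := dP h; rewrite /ball_/= sub0r normrN => /(_ hd).
by rewrite !fctE/= -diff_dotv [h + x]addrC opprD addrA.
Qed.

(** [diff] chooses a linear map with the defining property and defaults to 0; any map with that
    property would witness differentiability. *)
Lemma gradient_nondiff f x : ~ differentiable f x -> gradient f x = 0.
Proof.
move=> ndf; apply/rowP => i; rewrite !mxE /diff getPN// => df dfP.
apply: ndf; apply/diffP; apply: (@getPex _ (fun df : {linear 'rV[R]_n -> R} =>
  continuous df /\ forall y, f y = f (lim (nbhs x)) + df (y - lim (nbhs x))
    +o_(y \near x) (y - lim (nbhs x)))).
by exists df.
Qed.

(** A small step [s] along the gradient [v] itself would raise [f] by about [s * dotv v v]. *)
Lemma gradient_max f x : differentiable f x -> (forall y, f y <= f x) ->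
  gradient f x = 0.
Proof.
move=> df fx; set v := gradient f x.
apply: dotvv_eq0; apply/ler_addgt0Pr => e e0; rewrite add0r.
have v1 : 0 < `|v| + 1 by rewrite ltr_wpDl.
have [d d0 dP] := differentiable_gradientP df (divr_gt0 e0 v1).
pose s := d / 2 / (`|v| + 1).
have s0 : 0 < s by rewrite !divr_gt0.
have sv : `|s *: v| < d.
  rewrite normrZ gtr0_norm// /s mulrAC ltr_pdivrMr//.
  by have := normr_ge0 v; nra.
have := dP _ sv; rewrite dotvZr normrZ gtr0_norm// -/v ler_norml => /andP[H _].
have := fx (x + s *: v) => fxs.
have : s * dotv v v <= s * (e / (`|v| + 1) * `|v|) by lra.
rewrite ler_pM2l// => /le_trans; apply.
by rewrite mulrAC ler_pdivrMr// ler_wpM2l ?(ltW e0)// lerDl.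
Qed.

End gradient_facts.

(** * The truncated infimal convolution with a set *)

Section infconv.
Context {R : realType} {n : nat}.
Variables (L : 'rV[R]_n -> R) (A : set 'rV[R]_n) (u : R).
Hypotheses (u_gt0 : 0 < u) (L_ge0 : forall x, 0 <= L x).
Implicit Types (x y z : 'rV[R]_n).

(** The point [u] truncates the infimum and keeps the set nonempty even when [A] is empty. *)
Definition infconv x : R := inf ([set u] `|` [set L (x - y) | y in A]).

Let infconv_lb x : has_lbound ([set u] `|` [set L (x - y) | y in A]).
Proof. by exists 0 => _ [->|[y _ <-]] //; exact: ltW. Qed.

Lemma infconv_le x : infconv x <= u.
Proof. by apply: ge_inf => //; left. Qed.

Lemma infconv_le_at x y : A y -> infconv x <= L (x - y).
Proof. by move=> Ay; apply: ge_inf => //; right; exists y. Qed.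

Lemma infconv_ge0 x : 0 <= infconv x.
Proof.
apply: lb_le_inf; first by exists u; left.
by move=> _ [->|[y _ <-]] //; exact: ltW.
Qed.

Lemma infconv_lt x c : c <= u -> infconv x < c -> exists2 y, A y & L (x - y) < c.
Proof.
move=> cu /inf_lt[|_ [->|[y Ay <-]]]; first by exists u; left.
  by rewrite ltNge cu.
by exists y.
Qed.

Lemma infconv0 x : A x -> L 0 = 0 -> infconv x = 0.
Proof.
move=> Ax L0; apply/eqP; rewrite eq_le infconv_ge0 andbT -L0 -[in L _](subrr x).
exact: infconv_le_at.
Qed.

Lemma infconv_sublevel : [set x | infconv x < u] =
  minkowski_sum A [set x | L x < u].
Proof.
apply/seteqP; split => x /=.
  move=> /(infconv_lt (lexx u))[y Ay Lu]; exists y => //; exists (x - y) => //.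
  by rewrite addrC subrK.
move=> [a Aa [b /= Lb <-]]; apply: le_lt_trans Lb.
rewrite (_ : L b = L (a + b - a)); first exact: infconv_le_at.
by rewrite addrAC subrr add0r.
Qed.

(** A near-minimiser [y] for [x] also competes at [x']. If [|x - x'| < 1], then [x' - y] stays in
    the ball of radius [r + 1], where [L] has constant [M]; otherwise the bounds [0] and [u] on
    [infconv] suffice. *)
Lemma infconv_lipschitz r : 0 <= r -> (forall x, L x < u -> `|x| <= r) ->
  (exists2 M, 0 <= M & forall x x', `|x| <= r + 1 -> L x <= L x' + M * `|x - x'|) ->
  exists2 M, 0 <= M & forall x x', `|infconv x - infconv x'| <= M * `|x - x'|.
Proof.
move=> r0 Lr [M M0 MP]; exists (M + u); first by rewrite addr_ge0 ?(ltW u_gt0).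
suff H x x' : infconv x' <= infconv x + (M + u) * `|x - x'|.
  move=> x x'; rewrite ler_norml; have := H x x'; have := H x' x.
  by rewrite (distrC x' x); lra.
apply/ler_addgt0Pr => e e0.
have d0 := normr_ge0 (x - x').
have dM : 0 <= M * `|x - x'| by exact: mulr_ge0.
have du : 0 <= u * `|x - x'| by rewrite mulr_ge0 ?(ltW u_gt0).
have xu := infconv_le x'; have x0 := infconv_ge0 x.
have [ux|xu'] := leP u (infconv x); first by lra.
have [x1|/ltW x1] := leP 1 `|x - x'|.
  have : 0 <= u * (`|x - x'| - 1) by rewrite mulr_ge0 ?subr_ge0 ?(ltW u_gt0).
  lra.
have [y Ay] : exists2 y, A y & L (x - y) < Num.min u (infconv x + e).
  by apply: infconv_lt; rewrite ?ge_min ?lexx// lt_min xu' ltrDl.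
rewrite lt_min => /andP[Ly Le].
have := infconv_le_at x' Ay.
have := MP (x' - y) (x - y).
have -> : x' - y - (x - y) = x' - x by apply/rowP => i; rewrite !mxE; ring.
rewrite (distrC x' x) => H.
have : `|x' - y| <= r + 1.
  have -> : x' - y = (x - y) + (x' - x) by apply/rowP => i; rewrite !mxE; ring.
  by rewrite (le_trans (ler_normD _ _))// lerD ?Lr// distrC.
move=> /H; lra.
Qed.

End infconv.

(** * The gradient bound for the infimal convolution *)

Section infconv_gradient.
Context {R : realType} {n : nat}.
Variables (Psi L : 'rV[R]_n -> R) (A : set 'rV[R]_n) (u r lam : R).
Hypotheses (Psi_conv : convexR Psi) (Psi0 : Psi 0 = 0).
Hypotheses (L_ge0 : forall x, 0 <= L x) (L_conv : convexR L)
  (young : forall x y, dotv x y - Psi y <= L x)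
  (L_le : forall x c, (forall y, dotv x y - Psi y <= c) -> L x <= c)
  (lam_ge0 : 0 <= lam) (L_doubling : forall z, L (2 *: z) <= lam * L z).
Hypotheses (u_gt0 : 0 < u) (r_ge0 : 0 <= r)
  (L_bounded : forall x : 'rV[R]_n, L x < u -> `|x| <= r).

Let G := infconv L A u.

(* If [w] is a subgradient of [Psi] at [v := gradient G x], moving [x] in the direction [w - z], where
   [L z] is almost [G x], forces [Psi v + L z <= dotv v z] up to an error; doubling then bounds
   [dotv v z] by [Psi v / 2 + lam * L z]. *)
Lemma Psi_gradient_infconv x : Psi (gradient G x) <= 2 * lam * G x.
Proof.
have G0 : 0 <= G x by exact: infconv_ge0.
have lG0 : 0 <= 2 * lam * G x by rewrite !mulr_ge0.
have [df|ndf] := pselect (differentiable G x); last by rewrite gradient_nondiff// Psi0.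
have [uG|Gu] := leP u (G x).
  rewrite gradient_max ?Psi0// => y; apply: le_trans uG; exact: infconv_le.
set v := gradient G x.
have [w wP] := subgradient_exists v Psi_conv.
(* A subgradient gives the equality case of Young's inequality. *)
have Lw : L w <= dotv v w - Psi v.
  apply: L_le => y; have := wP y; rewrite dotvBr [dotv v w]dotvC; lra.
have halfv : Psi (2^-1 *: v) <= Psi v / 2.
  have := Psi_conv v 0 (_ : 0 <= 2^-1) (_ : 2^-1 <= 1).
  by rewrite scaler0 addr0 Psi0 mulr0 addr0 [_ * Psi v]mulrC; apply; lra.
pose C := `|w| + r.
have C0 : 0 <= C by rewrite addr_ge0.
suff H e : 0 < e -> e <= 1 -> Psi v / 2 <= lam * G x + (lam + 1 + C) * e.
  suff : Psi v / 2 <= lam * G x by lra.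
  apply/ler_addgt0Pr => e e0.
  have C1 : 0 < lam + 1 + C + 1 by have := lam_ge0; lra.
  have e'0 : 0 < Num.min 1 (e / (lam + 1 + C + 1)) by rewrite lt_min ltr01 divr_gt0.
  have e'1 : Num.min 1 (e / (lam + 1 + C + 1)) <= 1 by rewrite ge_min lexx.
  apply: (le_trans (H _ e'0 e'1)); rewrite lerD2l.
  apply: (@le_trans _ _ ((lam + 1 + C + 1) * Num.min 1 (e / (lam + 1 + C + 1)))).
    by rewrite ler_wpM2r ?(ltW e'0)// lerDl.
  by rewrite mulrC -ler_pdivlMr// ge_min lexx orbT.
move=> e0 e1.
have [d d0 dP] := differentiable_gradientP df e0.
have Cd : 0 < C + 1 by rewrite ltr_wpDl.
(* The three bounds keep the error below [e], keep [G x + s ^ 2] below the truncation level, and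
   keep the displacement [h] within [d]. The near-minimiser is taken up to [s ^ 2] so that an error
   [s] is left after division by [s]. *)
pose s := Num.min e (Num.min (u - G x) (d / (C + 1))).
have s0 : 0 < s by rewrite !lt_min e0 subr_gt0 Gu divr_gt0.
have se : s <= e by rewrite ge_min lexx.
have sG : s <= u - G x by rewrite !ge_min lexx orbT.
have sd : s * (C + 1) <= d by rewrite -ler_pdivlMr// !ge_min lexx !orbT.
clearbody s.
have s1 := le_trans se e1.
have ss : s ^+ 2 <= s by rewrite expr2 ler_piMr// ltW.
have Gsu : G x + s ^+ 2 <= u by move: ss sG; lra.
have GGs : G x < G x + s ^+ 2 by rewrite ltrDl exprn_gt0.
have [y Ay Ly] := infconv_lt Gsu GGs.
set z := x - y in Ly.
have zr : `|z| <= r by apply: L_bounded; lra.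
pose h := s *: (w - z).
have wz : `|w - z| <= C by rewrite (le_trans (ler_normB _ _))// lerD2l.
have hC : `|h| <= s * C by rewrite normrZ gtr0_norm// ler_pM2l.
have hd : `|h| < d by apply: le_lt_trans hC _; apply: lt_le_trans sd; rewrite ltr_pM2l// ltrDl.
have := dP h hd; rewrite ler_norml => /andP[Gh _].
(* Keeping the same [y], the moved point satisfies [x + h - y = s *: w + (1 - s) *: z], so convexity
   of [L] applies. *)
have Gxh : G (x + h) <= s * L w + (1 - s) * L z.
  apply: le_trans (L_conv w z (ltW s0) s1).
  have -> : s *: w + (1 - s) *: z = (x + h) - y.
    by apply/rowP => i; rewrite !mxE; ring.
  exact: infconv_le_at.
have eh : e * `|h| <= e * (s * C) by rewrite ler_pM2l.
have main : s * (dotv v w - dotv v z) <= s * (L w - L z + s + e * C).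
  by move: Gh; rewrite -/v /h dotvZr dotvBr -/h; lra.
rewrite ler_pM2l// in main.
(* Young's inequality for the pair [2 *: z] and [2^-1 *: v], which leaves half of [Psi v] to be
   absorbed. *)
have dz : dotv v z <= Psi v / 2 + lam * L z.
  have := young (2 *: z) (2^-1 *: v); rewrite dotvZl dotvZr mulrA mulfV ?pnatr_eq0// mul1r.
  by rewrite dotvC; have := L_doubling z; lra.
have Lz0 := L_ge0 z.
have lamL : lam * L z <= lam * (G x + e).
  by rewrite ler_wpM2l// (le_trans (ltW Ly))// lerD2l (le_trans ss).
lra.
Qed.

End infconv_gradient.

(** The integral of a nonnegative function is a supremum over simple functions below it, hence
    monotone without measurability. It serves for the gradient integrand of [mLSI]. *)
Lemma ge0_le_integral_nomeas d (T : measurableType d) (R : realType)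
    (mu : {measure set T -> \bar R}) (f g : T -> \bar R) :
  (forall x, (0 <= f x)%E) -> (forall x, (f x <= g x)%E) ->
  (\int[mu]_x f x <= \int[mu]_x g x)%E.
Proof.
move=> f0 fg; rewrite !ge0_integralTE// => [|x]; last exact: le_trans (f0 x) (fg x).
apply: le_ereal_sup => _ [h /= hf <-]; exists h => //= x.
exact: le_trans (hf x) (fg x).
Qed.

Lemma ln_comp_gradient {R : realType} {n : nat} (f : 'rV[R]_n -> R) x :
  0 < f x -> differentiable f x ->
  differentiable (@ln R \o f) x /\
  gradient (@ln R \o f) x = (f x)^-1 *: gradient f x.
Proof.
move=> fx0 df.
have dln : differentiable (@ln R) (f x).
  by apply/derivable1_diffP; apply: ex_derive; exact: is_derive1_ln.
split; first exact: differentiable_comp.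
apply/rowP => i; rewrite !mxE (diff_comp df dln) /= (diff1E dln) derive1E.
by have [_ ->] := is_derive1_ln fx0; rewrite mulrC.
Qed.

Lemma gradientZ {R : realType} {n : nat} (f : 'rV[R]_n -> R) (k : R) x :
  differentiable f x -> gradient (k *: f) x = k *: gradient f x.
Proof. by move=> df; apply/rowP => i; rewrite !mxE (diffZ k df). Qed.

(** Differentiability is assumed of the exponential, the function tested in [mLSI]; it passes to [G]
    through [G = s^-1 *: ln]. *)
Lemma gradient_expR {R : realType} {n : nat} (G : 'rV[R]_n -> R) (s : R) x :
  s != 0 -> differentiable (fun y => expR (s * G y)) x ->
  (expR (s * G x))^-1 *: gradient (fun y => expR (s * G y)) x = s *: gradient G x.
Proof.
set f := fun y => expR (s * G y) => s0 df.
have [dlf <-] := ln_comp_gradient (expR_gt0 _ : 0 < f x) df.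
have GE : G = s^-1 *: (@ln R \o f).
  apply/funext => y; rewrite !fctE/= expRK.
  by rewrite /GRing.scale/= mulrA mulVf// mul1r.
by rewrite [in RHS]GE gradientZ// scalerA mulfV// scale1r.
Qed.

Lemma expR_lipschitz {R : realType} (a b c : R) : a <= c -> b <= c ->
  `|expR a - expR b| <= expR c * `|a - b|.
Proof.
suff H (x y : R) : x <= c -> expR x - expR y <= expR c * `|x - y|.
  move=> ac bc; rewrite ler_norml H// andbT.
  by have := H _ a bc; rewrite distrC; lra.
move=> xc; have [xy|yx] := leP x y.
  apply: (@le_trans _ _ 0); first by rewrite subr_le0 ler_expR.
  by rewrite mulr_ge0// expR_ge0.
apply: (@le_trans _ _ (expR x * (x - y))).
  have := expR_ge1Dx (y - x); rewrite expRB.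
  rewrite ler_pdivlMr ?expR_gt0//; lra.
by rewrite gtr0_norm ?subr_gt0// ler_wpM2r ?subr_ge0 ?(ltW yx)// ler_expR.
Qed.

(** * The modified log-Sobolev inequality tested on exponentials *)

Section mLSI_exponential.
Context {R : realType} {n : nat}.
Variables (mu : probability (borelRn R n) R) (Psi G : 'rV[R]_n -> R).
Variables (D K alpha lam u M : R).
Hypotheses (D_gt0 : 0 < D) (K_ge1 : 1 <= K) (alpha_gt1 : 1 < alpha).
Hypotheses (Psi_ge0 : forall x, 0 <= Psi x) (Psi0 : Psi 0 = 0)
  (Psi_even : forall x, Psi (- x) = Psi x)
  (Psi_growth : forall (t : R) x, 1 <= t -> K^-1 * t `^ alpha * Psi x <= Psi (t *: x)).
Hypothesis lsi : mLSI mu (EFin \o Psi) D.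
Hypotheses (lam_ge0 : 0 <= lam) (M_ge0 : 0 <= M).
Hypotheses (G_ge0 : forall x, 0 <= G x) (G_le : forall x, G x <= u)
  (G_lip : forall x x', `|G x - G x'| <= M * `|x - x'|)
  (G_grad : forall x, Psi (gradient G x) <= 2 * lam * G x).
Implicit Types (x : 'rV[R]_n) (t s : R).

Lemma lipschitz_continuous : continuous G.
Proof.
move=> x; apply/(@cvgrPdist_lt _ _ _ _ (nbhs_filter x)) => e e0.
have M1 : 0 < M + 1 by rewrite ltr_wpDl.
have d0 : 0 < e / (M + 1) by rewrite divr_gt0.
apply/nbhs_ballP; exists (e / (M + 1)) => //= y; rewrite mx_norm_ball /ball_/= => xy.
apply: le_lt_trans (G_lip x y) _; rewrite ltr_pdivlMr// in xy.
apply: le_lt_trans xy; rewrite mulrC ler_wpM2l// lerDl//.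
Qed.

Lemma borel_measurable_lipschitz : measurable_fun [set: borelRn R n] G.
Proof.
apply: (measurability _ (RGenOInfty.measurableE R)) => // _ [_ [a ->] <-].
rewrite setTI; apply: sub_sigma_algebra.
by apply: open_comp => [x _|]; [exact: lipschitz_continuous|exact: interval_open].
Qed.

(** The growth bound read backwards, with factor [s^-1 >= 1] at the point [s *: v]. *)
Lemma Psi_contract s v : 0 <= s -> s <= 1 -> Psi (s *: v) <= K * s `^ alpha * Psi v.
Proof.
move=> s0 s1; have [->|sn0] := eqVneq s 0.
  by rewrite scale0r Psi0 !mulr_ge0 ?powR_ge0// (le_trans ler01).
have {sn0}s0 : 0 < s by rewrite lt_neqAle eq_sym sn0.
have K0 : 0 < K by exact: lt_le_trans K_ge1.
have := @Psi_growth s^-1 (s *: v); rewrite invf_ge1// scalerA mulVf ?gt_eqF// scale1r.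
move=> /(_ s1); rewrite -(powR_inv1 (ltW s0)) -powRrM mulN1r powRN.
have sa : 0 < s `^ alpha by rewrite powR_gt0.
move: (Psi (s *: v)) (Psi v) (s `^ alpha) sa => y z a a0 yz.
have -> : y = K * a * (K^-1 * a^-1 * y) by field; rewrite !gt_eqF.
by rewrite ler_pM2l// mulr_gt0.
Qed.

(** The half in the exponent makes [f t x ^+ 2] equal to [expR (t * G x)]. *)
Let f t x := expR (t / 2 * G x).

Let half_le t x : `|t| <= 2 -> t / 2 * G x <= u.
Proof.
move=> t2; apply: le_trans (G_le x).
rewrite -[leRHS]mul1r ler_wpM2r//; have := ler_norm t; lra.
Qed.

Let f_bounded t : `|t| <= 2 -> bounded_fun (f t).
Proof.
move=> t2; exists (expR u); split; first exact: num_real.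
move=> c /ltW uc x _ /=; apply: le_trans uc.
by rewrite ger0_norm ?expR_ge0// ler_expR half_le.
Qed.

Let f_lipschitz t : `|t| <= 2 -> [locally [lipschitz f t x | x in setT]].
Proof.
move=> t2; apply: lipschitz_locally.
apply: (@klipschitzW _ _ _ (expR u * M)).
  exact: (@globally_properfilter _ _ (0, 0)).
move=> [x y] _ /=; apply: le_trans (expR_lipschitz (half_le x t2) (half_le y t2)) _.
rewrite -[leRHS]mulrA ler_wpM2l ?expR_ge0//; apply: le_trans (G_lip x y).
rewrite -mulrBr normrM -[leRHS]mul1r ler_wpM2r// normrM normfV (@ger0_norm _ 2)//.
by rewrite ler_pdivrMr// mul1r.
Qed.

Let integrand t x : t != 0 -> `|t| <= 2 ->
  Psi ((f t x)^-1 *: gradient (f t) x) * f t x ^+ 2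
  <= 2 * lam * K * `|t| `^ alpha * (G x * expR (t * G x)).
Proof.
move=> tn0 t2.
have -> : f t x ^+ 2 = expR (t * G x).
  by rewrite -expRM_natl; congr expR; field.
rewrite [leRHS]mulrA; apply: ler_wpM2r; first exact: expR_ge0.
have [df|ndf] := pselect (differentiable (f t) x); last first.
  rewrite gradient_nondiff// scaler0 Psi0 !mulr_ge0 ?powR_ge0//.
  exact: le_trans K_ge1.
have th0 : t / 2 != 0 by rewrite mulf_neq0 ?invr_eq0 ?pnatr_eq0.
rewrite (gradient_expR th0 df).
(* Evenness replaces [t] by [|t|]; then [|t| <= 2] puts [|t| / 2] in the range of [Psi_contract]. *)
have -> : Psi ((t / 2) *: gradient G x) = Psi ((`|t| / 2) *: gradient G x).
  case: (ger0P t) => // _; by rewrite mulNr scaleNr Psi_even.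
have K0 : 0 <= K by exact: le_trans K_ge1.
have t20 : 0 <= `|t| / 2 by rewrite divr_ge0.
apply: le_trans (Psi_contract _ t20 _) _; first by rewrite ler_pdivrMr// mul1r.
have -> : 2 * lam * K * `|t| `^ alpha * G x = K * `|t| `^ alpha * (2 * lam * G x) by ring.
apply: ler_pM => //; first by rewrite mulr_ge0 ?powR_ge0.
rewrite ler_wpM2l//; apply: ge0_ler_powR; rewrite ?nnegrE//.
  by rewrite (le_trans ler01)// ltW.
by rewrite ler_pdivrMr// ler_peMr// ler1n.
Qed.

Let measurable_f2 t : measurable_fun [set: borelRn R n] (fun x => expR (t * G x)).
Proof.
apply: measurableT_comp => //; apply: measurable_funM => //.
exact: borel_measurable_lipschitz.
Qed.

Let int_Gexp t : mu.-integrable [set: borelRn R n] (EFin \o (fun x => G x * expR (t * G x))).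
Proof.
apply: (@bounded_integrableT _ _ _ _ _ (u * expR (`|t| * u))) => [|x].
  by apply: measurable_funM => //; exact: borel_measurable_lipschitz.
rewrite ger0_norm ?mulr_ge0 ?expR_ge0// ler_pM ?expR_ge0//.
exact: (@expRM_le _ (borelRn R n) R G u G_ge0 G_le).
Qed.

(** For [f t] the entropy is the left side, and [integrand] bounds the energy. The case [t = 0] is
    separate because [gradient_expR] divides by the exponent. *)
Lemma mLSI_mgf t : `|t| <= 2 ->
  t * mgf' mu G t - mgf mu G t * ln (mgf mu G t)
  <= 2 * D * lam * K * `|t| `^ alpha * mgf' mu G t.
Proof.
move=> t2; have [->|tn0] := eqVneq t 0.
  rewrite mul0r sub0r (_ : mgf mu G 0 = 1).
    by rewrite ln1 mulr0 oppr0 !mulr_ge0 ?powR_ge0 ?mgf'_ge0 ?(ltW D_gt0)// (le_trans ler01).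
  rewrite /mgf; under eq_Rintegral do rewrite mul0r expR0.
  transitivity (1 * fine (mu setT)); first exact: Rintegral_cst.
  by rewrite probability_setT mulr1.
have := @lsi (f t) (fun x => expR_gt0 (t / 2 * G x)) (f_bounded t2) (f_lipschitz t2).
have f2E : (fun x => f t x ^+ 2) = (fun x => expR (t * G x)).
  by apply/funext => x; rewrite -expRM_natl; congr expR; field.
rewrite f2E /entropy -/(mgf mu G t).
have -> : (\int[mu]_x (expR (t * G x) * ln (expR (t * G x)))%:E)%E = (t * mgf' mu G t)%:E.
  rewrite -RintegralZl// /Rintegral fineK.
    by apply: eq_integral => x _; rewrite expRK mulrC mulrA.
  apply: integrable_fin_num => //.
  exact: (@integrableZl _ _ _ mu _ measurableT t _ (int_Gexp t)).
rewrite -EFinB => H; rewrite -lee_fin; apply: (le_trans H).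
have -> : 2 * D * lam * K * `|t| `^ alpha * mgf' mu G t
  = D * (2 * lam * K * `|t| `^ alpha * mgf' mu G t) by ring.
rewrite EFinM lee_pmul2l//.
set c := 2 * lam * K * _.
have -> : (c * mgf' mu G t)%:E = (\int[mu]_x (c * (G x * expR (t * G x)))%:E)%E.
  rewrite -RintegralZl// /Rintegral fineK//.
  apply: integrable_fin_num => //.
  exact: (@integrableZl _ _ _ mu _ measurableT c _ (int_Gexp t)).
apply: ge0_le_integral_nomeas => x.
  by rewrite mule_ge0// lee_fin ?Psi_ge0// sqr_ge0.
by rewrite -EFinM lee_fin; exact: integrand.
Qed.

End mLSI_exponential.

(** * Real-valued consequences of the hypotheses on [Psi] *)

Section hypotheses_unpacked.
Context {R : realType} {n : nat}.
Variables (Psi : 'rV[R]_n -> R).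
Implicit Types (x y : 'rV[R]_n).

Lemma convex_function_convexR :
  convex_function [set: convex_lmodType 'rV[R]_n] Psi -> convexR Psi.
Proof.
move=> cvx s x y s0 s1.
exact: (cvx (Itv01 s0 s1) x y (in_setT _) (in_setT _)).
Qed.

Lemma condition_C_small : condition_C (EFin \o Psi) ->
  exists2 d : R, 0 < d & forall x, `|x| <= d -> Psi x <= 1.
Proof.
move=> HC.
have Psi0 : Psi 0 = 0 by have /= [] := C1_zero HC.
have : (Psi x)%:E @[x --> (0 : 'rV[R]_n)] --> (Psi 0)%:E := C1_continuous HC.
rewrite Psi0 => /fine_cvgP[_ Psi_cvg].
have := proj1 (@cvgrPdist_lt _ _ _ _ (nbhs_filter (0 : 'rV[R]_n)) _ _) Psi_cvg 1 ltr01.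
move=> /nbhs_ballP[d /= d0 dP].
exists (d / 2); first by rewrite divr_gt0.
move=> x xd; have := dP x; rewrite mx_norm_ball /ball_/= sub0r normrN.
have xd' : `|x| < d by apply: (le_lt_trans xd); rewrite gtr_pMr// invf_lt1// ltr1n.
by move=> /(_ xd'); rewrite sub0r normrN => /ltW/(le_trans (ler_norm _)).
Qed.

Lemma condition_C_large : condition_C (EFin \o Psi) ->
  exists2 r : R, 0 < r & forall x, r <= `|x| -> 1 <= Psi x.
Proof.
move=> HC; have [r rP] := C3 HC 1.
exists (Num.max r 0 + 1); first by rewrite ltr_wpDl// le_max lexx orbT.
move=> x rx; have := rP x; rewrite /= lte_fin => H; apply/ltW/H.
apply: lt_le_trans rx; rewrite ltr_pwDr// le_max lexx//.
Qed.

Lemma growth_condition_mul (K alpha beta : R) : condition_C (EFin \o Psi) ->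
  growth_condition K alpha beta Psi -> forall (t : R) x, 1 <= t ->
  K^-1 * t `^ alpha * Psi x <= Psi (t *: x).
Proof.
move=> HC HG t x t1; have [->|x0] := eqVneq x 0.
  by have /= [->] := C1_zero HC; rewrite scaler0; have /= [->] := C1_zero HC; rewrite mulr0.
have /andP[+ _] := HG x x0 t t1; rewrite ler_pdivlMr//.
by have := C2 HC x0; rewrite lte_fin.
Qed.

End hypotheses_unpacked.

(** * The time at which Herbst's argument is run *)

Section herbst_time.
Context {R : realType}.

(* The second argument of [min] makes [b * t0 ^ p = 1 / 3], the smallness that the dyadic
   comparison needs. *)
Definition herbst_time (a p : R) : R :=
  Num.min 1 ((3 * (2 * a / (1 - 2 `^ (- p))))^-1 `^ p^-1).

Lemma herbst_time_gt0 (a p : R) : 0 < a -> 0 < p -> 0 < herbst_time a p.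
Proof.
move=> a0 p0; rewrite lt_min ltr01 powR_gt0// invr_gt0 mulr_gt0// divr_gt0 ?mulr_gt0//.
by rewrite subr_gt0 pow2N_lt1.
Qed.

Lemma herbst_time_small (a p : R) : 0 < a -> 0 < p ->
  2 * a / (1 - 2 `^ (- p)) * herbst_time a p `^ p <= 1 / 3.
Proof.
move=> a0 p0; set b := 2 * a / _.
have b0 : 0 < b by rewrite divr_gt0 ?mulr_gt0// subr_gt0 pow2N_lt1.
have b3 : 0 <= (3 * b)^-1 by rewrite invr_ge0 mulr_ge0// ltW.
have : herbst_time a p `^ p <= (3 * b)^-1.
  have -> : (3 * b)^-1 = ((3 * b)^-1 `^ p^-1) `^ p.
    by rewrite -powRrM mulVf ?gt_eqF// powRr1.
  apply: ge0_ler_powR; rewrite ?nnegrE ?powR_ge0//; [exact: ltW|exact/ltW/herbst_time_gt0|].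
  by rewrite /herbst_time -/b ge_min lexx orbT.
rewrite -(ler_pM2l b0) => /le_trans; apply.
by rewrite le_eqVlt; apply/orP; left; apply/eqP; field; rewrite gt_eqF.
Qed.

End herbst_time.

Theorem corollary3p9 (R : realType) (alpha beta K D : R)
    (halpha1 : 1 < alpha) (halpha2 : alpha <= 2) (hbeta : 2 <= beta)
    (hK : 1 <= K) (hD : 0 < D) :
  exists2 C : R, 0 < C &
    forall (n : nat) (Psi : 'rV[R]_n -> R) (mu : probability (borelRn R n) R),
      convex_function [set: convex_lmodType 'rV[R]_n] Psi ->
      condition_C (EFin \o Psi) ->
      growth_condition K alpha beta Psi ->
      mu `<< (@lebesgueRn R n : set (borelRn R n) -> \bar R) ->
      mLSI mu (EFin \o Psi) D ->
      forall A : set (borelRn R n), measurable A -> ((1 / 2)%:E <= mu A)%E ->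
      forall u : R, 0 < u ->
        ((1 - 2 * expR (beta - u / C))%:E <=
          mu (minkowski_sum A
                [set x | (legendre (EFin \o Psi) x < u%:E)%E]))%E.
Proof.

(* All constants are fixed before [n], [Psi] and [mu]; [a] is the constant of [mLSI_mgf]. *)
pose p := alpha - 1; pose lam := doubling K alpha; pose a := 2 * D * lam * K.
have p0 : 0 < p by rewrite subr_gt0.
have K0 : 0 < K by exact: lt_le_trans hK.
have lam0 : 0 < lam by apply: lt_le_trans (doubling_ge2 halpha1 hK).
have a0 : 0 < a by exact: mulr_gt0 (mulr_gt0 (mulr_gt0 (ltr0n R 2) hD) lam0) K0.
have t00 := herbst_time_gt0 a0 p0; have t0b := herbst_time_small a0 p0.
(* The minimum with 1 keeps every time used within the range of [mLSI_mgf]. *)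
have t02 : herbst_time a p <= 2 by rewrite ge_min ler1n.
set t0 := herbst_time a p in t00 t0b t02.
exists t0^-1; first by rewrite invr_gt0.
move=> n Psi mu cvx HC HG _ lsi A mA muA u u0.
have Psi_ge0 x : 0 <= Psi x by have := C_ge0 HC x; rewrite lee_fin.
have Psi0 : Psi 0 = 0 by have /= [] := C1_zero HC.
have Psi_even x : Psi (- x) = Psi x by have /= [] := C6 HC x.
have Psi_conv := convex_function_convexR cvx.
have Psi_growth := growth_condition_mul HC HG.
have [d d0 Psi_small] := condition_C_small HC.
have [rho rho0 Psi_large] := condition_C_large HC.
pose L := conjugate Psi.
have LE : forall x, legendre (EFin \o Psi) x = (L x)%:E by
  exact: legendreE halpha1 hK Psi_ge0 Psi0 Psi_growth rho0 Psi_large.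
have L_ge0 : forall x, 0 <= L x by exact: conj_ge0 halpha1 hK Psi_ge0 Psi0 Psi_growth rho0 Psi_large.
have L0 : L 0 = 0 by exact: conj0 halpha1 hK Psi_ge0 Psi0 Psi_growth rho0 Psi_large.
have L_conv : convexR L by exact: conj_convex halpha1 hK Psi_ge0 Psi0 Psi_growth rho0 Psi_large.
have young : forall x y, dotv x y - Psi y <= L x by
  exact: le_conj halpha1 hK Psi_ge0 Psi0 Psi_growth rho0 Psi_large.
have L_le : forall x c, (forall y, dotv x y - Psi y <= c) -> L x <= c.
  by exact: conj_le halpha1 hK Psi_ge0 Psi0 Psi_growth rho0 Psi_large.
have L_doubling : forall z, L (2 *: z) <= lam * L z by
  exact: conj_doubling halpha1 hK Psi_ge0 Psi0 Psi_growth rho0 Psi_large.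
have L_coercive : forall x, d * `|x| <= L x + 1.
  by exact: conj_coercive halpha1 hK Psi_ge0 Psi0 Psi_growth d0 Psi_small rho0 Psi_large.
(* Radius given by coercivity: [L x < u] implies [d * |x| <= u + 1]. *)
pose r := (u + 1) / d.
have r0 : 0 <= r by rewrite divr_ge0 ?addr_ge0// ltW.
have L_bounded (x : 'rV[R]_n) : L x < u -> `|x| <= r.
  by move=> Lu; rewrite ler_pdivlMr// mulrC (le_trans (L_coercive x))// lerD2r ltW.
have L_lip : exists2 M : R, 0 <= M &
    forall x x' : 'rV[R]_n, `|x| <= r + 1 -> L x <= L x' + M * `|x - x'|.
  have r10 : 0 <= r + 1 by rewrite addr_ge0.
  have [M M0 MP] := conj_lipschitz_ball halpha1 hK Psi_ge0 Psi0 Psi_growth rho0 Psi_large r10.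
  by exists M.
pose G := infconv L A u.
have [M M0 G_lip] := infconv_lipschitz A u0 L_ge0 r0 L_bounded L_lip.
have G_ge0 : forall x, 0 <= G x by exact: infconv_ge0.
have G_le : forall x, G x <= u by exact: infconv_le.
have G_grad : forall x, Psi (gradient G x) <= 2 * lam * G x.
  exact: (Psi_gradient_infconv A Psi_conv Psi0 L_ge0 L_conv young L_le (ltW lam0)
    L_doubling u0 r0 L_bounded).
have mG := borel_measurable_lipschitz M0 G_lip.
have lsiG t : `|t| <= t0 -> t * mgf' mu G t - mgf mu G t * ln (mgf mu G t)
    <= a * `|t| `^ (1 + p) * mgf' mu G t.
  move=> tt0; rewrite [1 + p]addrC subrK.
  exact: (mLSI_mgf hD hK halpha1 Psi_ge0 Psi0 Psi_even Psi_growth lsi (ltW lam0) M0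
    G_ge0 G_le G_lip G_grad (le_trans tt0 t02)).
have GA x : A x -> G x = 0 by move=> Ax; exact: infconv0.
have := herbst_concentration mG G_ge0 G_le a0 p0 t00 t0b lsiG mA muA GA.
rewrite infconv_sublevel//.
have -> : [set x | L x < u] = [set x | (legendre (EFin \o Psi) x < u%:E)%E].
  by apply/seteqP; split => x /=; rewrite LE lte_fin.
apply: le_trans; rewrite lee_fin lerD2l lerN2 invrK [u * t0]mulrC expRD mulrA.
rewrite ler_wpM2r ?expR_ge0//.
(* Since [beta >= 2], [expR beta >= 3], so the factor 4 is at most [2 * expR beta]. *)
have := expR_ge1Dx beta; lra.
Qed.
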